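(* For $n\ge 0$ let $B_n$ be the set of inversion sequences $e\in\mathbf{I}_n$ for which there are no indices $i<j<k$ with $e_i>e_j<e_k$. Then $$\sum_{n\ge0}\sum_{e\in B_n}z^nt^{\mathrm{dist}(e)}=\frac{1+z(2-t)-z^2(1-t)-(1-z)\sqrt{(1+z-zt)^2-\frac{4z(1-z+zt)}{1-z}}}{2z(2-z)}.$$
   Context: An inversion sequence of length $n$ is an integer sequence $e=e_1\dots e_n$ with $0\le e_i<i$ for all $i$; $\mathbf{I}_n$ is the set of these, and $\mathbf{I}_0$ consists only of the empty sequence. For $e\in\mathbf{I}_n$, $\mathrm{dist}(e)=|\{e_1,\dots,e_n\}|$ is the number of distinct entries. In the paper's notation $B_n=\mathbf{I}_n(>,<,-)$. *)

(* Defs.v *)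
From HB Require Import structures.
From mathcomp Require Import all_boot all_order all_algebra.
From mathcomp Require Import boolp.

Set Implicit Arguments.
Unset Strict Implicit.
Unset Printing Implicit Defensive.

Import GRing.Theory.
Local Open Scope ring_scope.

(* [Fps a] is the formal power series [\sum_n a n * z ^+ n]. *)
Record fps (R : Type) := Fps { fcoef : nat -> R }.
Arguments Fps {R}.

HB.instance Definition _ (R : Type) := gen_eqMixin (fps R).
HB.instance Definition _ (R : Type) := gen_choiceMixin (fps R).

Lemma fpsP (R : Type) (f g : fps R) : (forall n, fcoef f n = fcoef g n) <-> f = g.
Proof.
split=> [|-> //]; case: f g => [f] [g] /= fg.
by congr Fps; apply: funext.
Qed.

Section FpsZmodule.
Variable R : zmodType.
Implicit Types f g h : fps R.

Definition fps_zero : fps R := Fps (fun=> 0).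
Definition fps_opp f := Fps (fun n => - fcoef f n).
Definition fps_add f g := Fps (fun n => fcoef f n + fcoef g n).

Fact fps_addA : associative fps_add.
Proof. by move=> f g h; apply/fpsP => n /=; rewrite addrA. Qed.
Fact fps_addC : commutative fps_add.
Proof. by move=> f g; apply/fpsP => n /=; rewrite addrC. Qed.
Fact fps_add0 : left_id fps_zero fps_add.
Proof. by move=> f; apply/fpsP => n /=; rewrite add0r. Qed.
Fact fps_addN : left_inverse fps_zero fps_opp fps_add.
Proof. by move=> f; apply/fpsP => n /=; rewrite addNr. Qed.

HB.instance Definition _ :=
  GRing.isZmodule.Build (fps R) fps_addA fps_addC fps_add0 fps_addN.

Lemma fcoef0 n : fcoef (0 : fps R) n = 0. Proof. by []. Qed.
Lemma fcoefN f n : fcoef (- f) n = - fcoef f n. Proof. by []. Qed.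
Lemma fcoefD f g n : fcoef (f + g) n = fcoef f n + fcoef g n. Proof. by []. Qed.
Lemma fcoefB f g n : fcoef (f - g) n = fcoef f n - fcoef g n. Proof. by []. Qed.
End FpsZmodule.

Section FpsRing.
Variable R : comNzRingType.
Implicit Types f g h : fps R.

Definition fpsC (c : R) : fps R := Fps (fun n => if n == 0%N then c else 0).
Definition fpsX : fps R := Fps (fun n => (n == 1%N)%:R).
Definition fps_mul f g :=
  Fps (fun n => \sum_(i < n.+1) fcoef f i * fcoef g (n - i)%N).

Let trunc n f : {poly R} := \poly_(i < n.+1) fcoef f i.

Let coef_trunc n f i : (i <= n)%N -> (trunc n f)`_i = fcoef f i.
Proof. by move=> le_in; rewrite coef_poly ltnS le_in. Qed.

Let fcoef_mul_trunc n f g i :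
  (i <= n)%N -> fcoef (fps_mul f g) i = (trunc n f * trunc n g)`_i.
Proof.
move=> le_in; rewrite coefM /=; apply: eq_bigr => j _.
rewrite !coef_trunc //; first by rewrite (leq_trans (leq_subr _ _)).
by rewrite (leq_trans (leq_ord j)).
Qed.

Fact fps_mulA : associative fps_mul.
Proof.
move=> f g h; apply/fpsP => n.
transitivity ((trunc n f * (trunc n g * trunc n h))`_n).
  rewrite coefM; apply: eq_bigr => j _.
  by rewrite coef_trunc ?leq_ord // -fcoef_mul_trunc // leq_subr.
rewrite mulrA coefM; apply: eq_bigr => j _.
by rewrite -fcoef_mul_trunc ?leq_ord // coef_trunc // leq_subr.
Qed.

Fact fps_mulC : commutative fps_mul.
Proof.
move=> f g; apply/fpsP => n.
by rewrite !(@fcoef_mul_trunc n) // mulrC.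
Qed.

Fact fps_mul1 : left_id (fpsC 1) fps_mul.
Proof.
move=> f; apply/fpsP => n /=.
rewrite big_ord_recl /= mul1r subn0 big1 ?addr0 // => i _.
by rewrite mul0r.
Qed.

Fact fps_mulDl : left_distributive fps_mul +%R.
Proof.
move=> f g h; apply/fpsP => n /=; rewrite -big_split.
by apply: eq_bigr => i _; rewrite mulrDl.
Qed.

Fact fps_oner_neq0 : fpsC 1 != 0.
Proof.
by apply/eqP => /fpsP /(_ 0%N) /= /eqP; rewrite oner_eq0.
Qed.

HB.instance Definition _ := GRing.Zmodule_isComNzRing.Build (fps R)
  fps_mulA fps_mulC fps_mul1 fps_mulDl fps_oner_neq0.

Lemma fcoef1 n : fcoef (1 : fps R) n = (n == 0%N)%:R.
Proof. by case: n. Qed.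

Lemma fcoefM f g n :
  fcoef (f * g) n = \sum_(i < n.+1) fcoef f i * fcoef g (n - i)%N.
Proof. by []. Qed.

Lemma fcoefM0 f g : fcoef (f * g) 0 = fcoef f 0 * fcoef g 0.
Proof. by rewrite fcoefM big_ord1. Qed.

Lemma fpsC_is_zmod_morphism : zmod_morphism fpsC.
Proof. by move=> a b; apply/fpsP => -[|n] //=; rewrite subr0. Qed.

Lemma fpsC_is_monoid_morphism : monoid_morphism fpsC.
Proof.
split=> // a b; apply/fpsP => n; rewrite fcoefM big_ord_recl /= subn0 big1 => [|i _].
  by case: n => [|n] /=; rewrite addr0 ?mulr0.
by rewrite mul0r.
Qed.

HB.instance Definition _ :=
  GRing.isZmodMorphism.Build R (fps R) fpsC fpsC_is_zmod_morphism.
HB.instance Definition _ :=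
  GRing.isMonoidMorphism.Build R (fps R) fpsC fpsC_is_monoid_morphism.

End FpsRing.
Arguments fpsX {R}.

Section CourseOfValues.
Variables (R : nmodType) (F : (nat -> R) -> nat -> R).

Fixpoint cov_prefix n : seq R :=
  if n is m.+1 then rcons (cov_prefix m) (F (nth 0 (cov_prefix m)) m) else [::].

(* The sequence [g] such that [g n = F g n], when [F g n] only depends on the
   values of [g] below [n] (see [cov_recE]). *)
Definition cov_rec n := nth 0 (cov_prefix n.+1) n.

Let size_prefix n : size (cov_prefix n) = n.
Proof. by elim: n => //= n IHn; rewrite size_rcons IHn. Qed.

Let nth_prefix n i : (i < n)%N -> nth 0 (cov_prefix n) i = cov_rec i.
Proof.
elim: n => // n IHn; rewrite ltnS leq_eqVlt => /predU1P[-> //|lt_in].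
by rewrite /= nth_rcons size_prefix lt_in IHn.
Qed.

Lemma cov_recE :
  (forall g h n, (forall i, (i < n)%N -> g i = h i) -> F g n = F h n) ->
  forall n, cov_rec n = F cov_rec n.
Proof.
move=> ext n; rewrite {1}/cov_rec /= nth_rcons size_prefix ltnn eqxx.
by apply: ext => i /nth_prefix.
Qed.
End CourseOfValues.

Section FpsUnitRing.
Variable R : comUnitRingType.
Implicit Types f g : fps R.

Definition fps_inv_step f (g : nat -> R) n : R :=
  if n == 0%N then (fcoef f 0)^-1
  else - (fcoef f 0)^-1 * \sum_(i < n) g i * fcoef f (n - i)%N.

Definition fps_unit : {pred fps R} := fun f => fcoef f 0 \is a GRing.unit.

Definition fps_inv f : fps R :=
  if f \in fps_unit then Fps (cov_rec (fps_inv_step f)) else f.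

Fact fps_mulVf : {in fps_unit, left_inverse 1 fps_inv *%R}.
Proof.
move=> f Uf; rewrite /fps_inv Uf; apply/fpsP => n.
have E := @cov_recE _ (fps_inv_step f) _.
rewrite fcoefM big_ord_recr /= subnn E; last first.
  move=> g h m gh; rewrite /fps_inv_step; case: ifP => // _; congr (_ * _).
  by apply: eq_bigr => i _; rewrite gh.
rewrite {2}/fps_inv_step; case: n => [|n] /=.
  by rewrite big_ord0 add0r mulVr.
by rewrite !mulNr mulrAC mulVr // mul1r addrN.
Qed.

Fact fps_unitPl f g : g * f = 1 -> f \in fps_unit.
Proof.
move/fpsP/(_ 0%N); rewrite fcoefM0 fcoef1 => gf1.
by apply/unitrPr; exists (fcoef g 0); rewrite mulrC.
Qed.

Fact fps_inv_out : {in [predC fps_unit], fps_inv =1 id}.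
Proof. by move=> f; rewrite inE /= /fps_inv => /negPf ->. Qed.

HB.instance Definition _ := GRing.ComNzRing_hasMulInverse.Build (fps R)
  fps_mulVf fps_unitPl fps_inv_out.

Lemma fps_unitE f : (f \is a GRing.unit) = (fcoef f 0 \is a GRing.unit).
Proof. by []. Qed.

Definition fps_sqrt_step f (g : nat -> R) n : R :=
  if n == 0%N then 1
  else (fcoef f n - \sum_(1 <= i < n) g i * g (n - i)%N) / 2.

(* The square root with constant coefficient 1 of a series with constant
   coefficient 1 (see [fps_sqrtK] and [fps_sqrt_uniq]); junk otherwise. *)
Definition fps_sqrt f : fps R := Fps (cov_rec (fps_sqrt_step f)).

Lemma fcoef_sqrt f n :
  fcoef (fps_sqrt f) n = fps_sqrt_step f (fcoef (fps_sqrt f)) n.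
Proof.
apply: cov_recE => g h m gh; rewrite /fps_sqrt_step; case: ifP => // m0.
congr ((_ - _) / _); apply: eq_big_nat => i /andP[i_gt0 lt_im].
by rewrite !gh // ltn_subrL i_gt0 lt0n m0.
Qed.

Lemma fcoef_sqrt0 f : fcoef (fps_sqrt f) 0 = 1.
Proof. by rewrite fcoef_sqrt. Qed.

Lemma fcoef_sqr f n : fcoef f 0 = 1 ->
  fcoef (f ^+ 2) n.+1 =
  fcoef f n.+1 * 2 + \sum_(1 <= i < n.+1) fcoef f i * fcoef f (n.+1 - i)%N.
Proof.
move=> f0; rewrite expr2 fcoefM -(big_mkord xpredT (fun i => _ i * _ (_ - i)%N)).
rewrite big_nat_recl // big_nat_recr //= subn0 subnn f0 mul1r mulr1.
by rewrite [in RHS]big_add1 /= addrCA addrC -mulr2n mulr_natr.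
Qed.

Lemma fps_sqrtK f : 2 \is a @GRing.unit R -> fcoef f 0 = 1 -> fps_sqrt f ^+ 2 = f.
Proof.
move=> U2 f0; apply/fpsP => -[|n].
  by rewrite expr2 fcoefM0 fcoef_sqrt0 mulr1 f0.
by rewrite fcoef_sqr ?fcoef_sqrt0 // {1}fcoef_sqrt /fps_sqrt_step /= divrK // subrK.
Qed.

Lemma fps_sqrt_uniq f g : 2 \is a @GRing.unit R ->
  fcoef g 0 = 1 -> g ^+ 2 = f -> g = fps_sqrt f.
Proof.
move=> U2 g0 <-; apply/fpsP; elim/ltn_ind => -[|n] IHn.
  by rewrite fcoef_sqrt0.
rewrite fcoef_sqrt /fps_sqrt_step fcoef_sqr //=.
set S := \sum_(1 <= i < n.+1) _; set S' := \sum_(1 <= i < n.+1) _.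
suff -> : S' = S by rewrite addrK mulrK.
apply: eq_big_nat => i /andP[i_gt0 lt_in].
by rewrite !IHn // ltn_subrL i_gt0.
Qed.
End FpsUnitRing.

Section FpsIdomain.
Variable R : idomainType.

Fact fps_integral (f g : fps R) : f * g = 0 -> (f == 0) || (g == 0).
Proof.
have nz (h : fps R) : h != 0 -> exists n, fcoef h n != 0.
  move=> h0; apply: contrapT => nh; case/eqP: h0; apply/fpsP => n.
  by apply: contrapT => hn; apply: nh; exists n; apply/eqP.
move=> fg0; apply/norP => -[/nz f0 /nz g0]; move: fg0.
case: (ex_minnP f0) => i fi mini; case: (ex_minnP g0) => j gj minj.
move/fpsP/(_ (i + j)%N)/eqP; rewrite fcoefM fcoef0.
have lt_i : (i < (i + j).+1)%N by rewrite ltnS leq_addr.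
rewrite (bigD1 (Ordinal lt_i)) //= addKn big1 ?addr0 => [|k].
  by rewrite mulf_eq0 (negPf fi) (negPf gj).
rewrite -val_eqE /= neq_ltn => /orP[lt_ki|lt_ik].
  by case: (eqVneq (fcoef f k) 0) => [->|/mini]; rewrite ?mul0r // leqNgt lt_ki.
case: (eqVneq (fcoef g (i + j - k)) 0) => [->|/minj]; rewrite ?mulr0 //.
by rewrite leqNgt ltn_subLR ?ltn_add2r ?lt_ik // -ltnS.
Qed.

HB.instance Definition _ :=
  GRing.ComUnitRing_isIntegral.Build (fps R) fps_integral.
End FpsIdomain.

Section InversionSequences.
Variable n : nat.
Implicit Type e : {ffun 'I_n -> 'I_n}.

(* Positions are numbered from 0, so [e_i < i] for [1 <= i <= n] becomes
   [e i < i.+1]; all entries are then below [n]. *)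
Definition inversion_seqs : {set {ffun 'I_n -> 'I_n}} :=
  [set e : {ffun 'I_n -> 'I_n} | [forall i : 'I_n, e i < i.+1]%N].

Definition avoids_gt_lt e : bool :=
  ~~ [exists i : 'I_n, exists j : 'I_n, exists k : 'I_n,
        [&& i < j, j < k, e i > e j & e j < e k]%N].

Definition Bset : {set {ffun 'I_n -> 'I_n}} :=
  [set e in inversion_seqs | avoids_gt_lt e].

Definition dist e : nat := #|[set e i | i : 'I_n]|.
End InversionSequences.

(* The series [\sum_n \sum_(e in B_n) z^n t^(dist e)] in [rat[t][[z]]]. *)
Definition Bgf : fps {poly rat} :=
  Fps (fun n => \sum_(e in Bset n) 'X^(dist e)).

(* Main.v *)
Require Import Defs.
From mathcomp Require Import all_boot all_order all_algebra.
From mathcomp Require Import boolp zify ring.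

(* Avoiding [e_i > e_j < e_k] means being unimodal. Relax the bound to
   [e_i < i + k] (positions from 0), and let [T_k] be the series of these
   sequences by [t^(number of values)], [F_k] that of the sequences with bound
   [k + 1] by [t^(number of nonzero values)], and [K_k] the part of [F_k] whose
   sequences do not start with 0. In a unimodal sequence the zeros form an
   initial and a final block, so stripping them one at a time, and decrementing
   a sequence without zeros, gives
     [T_0 = 1], [T_(k+1) = t F_k + (1 - t) T_k],
     [F_k = K_k + z F_(k+1)], [K_k = T_k + z (K_k - 1)],
   which has only one solution. If [Y] is the power series with
   [(1 - z) (1 - z Y) (Y - 1 + t) = t], then
   [T_k = 1 / (2 - z) + (1 - z) / (2 - z) * Y^k] solves it; the theorem is the
   case [k = 1], as [2 z Y = 1 + z - z t - sqrt D] for the [D] of the theorem. *)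

Set Implicit Arguments.
Unset Strict Implicit.
Unset Printing Implicit Defensive.

Import GRing.Theory.
Local Open Scope ring_scope.

(** * Unimodal words and the removal of zeros *)

Section Words.
Local Open Scope nat_scope.
Implicit Types (k n : nat) (s : seq nat).

Definition unimodal s : Prop :=
  forall i j l, i < j < l -> l < size s ->
  nth 0 s j < nth 0 s i -> nth 0 s l <= nth 0 s j.

Definition bounded k s : Prop := forall i, i < size s -> nth 0 s i < i + k.

Definition admissible k s : Prop := bounded k s /\ unimodal s.

(** Every entry of an admissible word of length [n] is below [n + k], so these tuples miss none. As
    plain lists, words of different lengths and bounds share one type. *)
Definition words k n : seq (seq nat) :=
  [seq s <- [seq map val (val u) | u <- enum {: n.-tuple 'I_(n + k)}]
     | `[<admissible k s>]].

Lemma words_uniq k n : uniq (words k n).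
Proof.
apply: filter_uniq; rewrite map_inj_uniq ?enum_uniq // => u v uv.
by apply/val_inj/(inj_map val_inj).
Qed.

Lemma mem_words k n s :
  reflect (size s = n /\ admissible k s) (s \in words k n).
Proof.
rewrite mem_filter; apply: (iffP andP) => [[/asboolP adm_s /mapP[u _ def_s]]|].
  by rewrite def_s size_map size_tuple -def_s.
move=> [sz_s adm_s]; split; first exact/asboolP.
have lt_s i : i < n -> nth 0 s i < n + k.
  by rewrite -sz_s => lt_i; move: (proj1 adm_s i lt_i); lia.
have sz_u : size (pmap insub s : seq 'I_(n + k)) == n.
  rewrite size_pmap_sub -sz_s -all_count; apply/(all_nthP 0) => i.
  by rewrite sz_s => /lt_s.
apply/mapP; exists (Tuple sz_u); first by rewrite mem_enum.
rewrite /= pmap_filter; last exact: insubK.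
rewrite (_ : [seq _ <- s | _] = s) //; apply/all_filterP/(all_nthP 0) => i.
by rewrite sz_s => /lt_s lt_i; rewrite insubT.
Qed.

Lemma unimodal_behead x s : unimodal (x :: s) -> unimodal s.
Proof. by move=> uni i j l ijl lt_l; apply: (uni i.+1 j.+1 l.+1). Qed.

(** An end of a valley exceeds its middle, hence is positive; so a 0 in first or, as in
    [unimodal_rcons0], in last place belongs to no valley. *)
Lemma unimodal_cons0 s : unimodal (0 :: s) <-> unimodal s.
Proof.
split=> [|uni [|i] [|j] [|l] //=]; first exact: unimodal_behead.
by rewrite !ltnS; apply: uni.
Qed.

Lemma unimodal_rcons0 s : unimodal (rcons s 0) <-> unimodal s.
Proof.
split=> uni i j l /andP[ij jl].
  move=> lt_l; have lt_j := ltn_trans jl lt_l; have lt_i := ltn_trans ij lt_j.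
  move: (uni i j l); rewrite ij jl size_rcons !nth_rcons lt_l lt_j lt_i.
  by apply=> //; apply: ltnW.
rewrite size_rcons ltnS leq_eqVlt !nth_rcons => /predU1P[->|lt_l].
  by rewrite ltnn eqxx.
have lt_j := ltn_trans jl lt_l; have lt_i := ltn_trans ij lt_j.
by rewrite lt_l lt_j lt_i; apply: uni; rewrite ?ij.
Qed.

Lemma unimodal_mapS s : unimodal (map succn s) <-> unimodal s.
Proof.
split=> uni i j l ijl; move: (uni i j l ijl); rewrite size_map => {}uni lt_l;
  move: (uni lt_l); rewrite !(nth_map 0); lia.
Qed.

(** Removing the first entry lowers every position by one, so the bound parameter rises by one. *)
Lemma bounded_cons0 k s : bounded k.+1 (0 :: s) <-> bounded k.+2 s.
Proof.
split=> [bnd i lt_i|bnd [|i] //=]; first by move: (bnd i.+1 lt_i) => /=; lia.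
by rewrite ltnS => /bnd; lia.
Qed.

Lemma bounded_rcons0 k s : bounded k.+1 (rcons s 0) <-> bounded k.+1 s.
Proof.
split=> bnd i.
  by move=> lt_i; move: (bnd i); rewrite size_rcons nth_rcons lt_i; apply; lia.
rewrite size_rcons nth_rcons => _; case: (ltnP i (size s)) => [/bnd //|_].
by case: ifP; lia.
Qed.

Lemma bounded_mapS k s : bounded k.+1 (map succn s) <-> bounded k s.
Proof.
by split=> bnd i; move: (bnd i); rewrite size_map => {}bnd lt_i;
   move: (bnd lt_i); rewrite (nth_map 0) //; lia.
Qed.

Lemma admissible_cons0 k s : admissible k.+1 (0 :: s) <-> admissible k.+2 s.
Proof. by rewrite /admissible bounded_cons0 unimodal_cons0. Qed.

Lemma admissible_rcons0 k s : admissible k.+1 (rcons s 0) <-> admissible k.+1 s.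
Proof. by rewrite /admissible bounded_rcons0 unimodal_rcons0. Qed.

Lemma admissible_mapS k s : admissible k.+1 (map succn s) <-> admissible k s.
Proof. by rewrite /admissible bounded_mapS unimodal_mapS. Qed.

(* A value 0 lying strictly between the positive first and last entries would
   be a valley. *)
Lemma unimodal_last0 s :
  unimodal s -> head 1 s != 0 -> 0 \in s -> exists s', s = rcons s' 0.
Proof.
case/lastP: s => // s y uni; rewrite mem_rcons in_cons.
case: y uni => [|y] uni hd /=; first by exists s.
move=> /(nthP 0)[j]; case: s uni hd => // x s uni /= hd.
case: j => [|j] /= lt_j s_j; first by rewrite s_j in hd.
move: (uni 0 j.+1 (size s).+1); rewrite /= size_rcons !nth_rcons ltnn eqxx.
rewrite ltnS in lt_j; rewrite lt_j s_j lt0n hd !ltnS lt_j.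
by move=> /(_ isT (leqnn _) isT).
Qed.

End Words.

(** * Weights and bijections between sets of words *)

Section Series.
Implicit Types (k n : nat) (s : seq nat).

Definition wt s : {poly rat} := 'X^(size (undup s)).
Definition wt_pos s : {poly rat} := 'X^(size (undup [seq x <- s | x != 0%N])).

Lemma wtE s : wt s = (if 0%N \in s then 'X else 1) * wt_pos s.
Proof.
rewrite /wt /wt_pos -filter_undup size_filter -(count_predC (pred1 0%N)).
rewrite -[count _ _ in LHS]/(count_mem 0%N _) count_uniq_mem ?undup_uniq //.
rewrite mem_undup exprD; congr (_ * _).
by case: ifP.
Qed.

(** The bijection is [map succn], which turns all values into nonzero ones. *)
Lemma sum_words_pos k n :
  \sum_(s <- words k.+1 n | 0%N \notin s) wt_pos s = \sum_(s <- words k n) wt s.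
Proof.
rewrite -big_filter.
have wtS s : wt_pos (map succn s) = wt s.
  rewrite /wt /wt_pos (_ : filter _ _ = map succn s); last first.
    by apply/all_filterP; rewrite all_map; apply/allP.
  by rewrite undup_map_inj ?size_map //; apply: succn_inj.
rewrite -(eq_bigr _ (fun s _ => wtS s)) -(big_map (map succn) xpredT wt_pos).
apply: perm_big; apply: uniq_perm.
- by rewrite filter_uniq // words_uniq.
- by rewrite map_inj_uniq ?words_uniq //; apply/inj_map/succn_inj.
move=> s; rewrite mem_filter; apply/andP/mapP => [[s0 /mem_words[sz adm]]|].
  have def_s : s = map succn (map predn s).
    rewrite -map_comp -[LHS]map_id; apply/eq_in_map => -[|x] //= s_0.
    by rewrite s_0 in s0.
  exists (map predn s) => //; apply/mem_words; rewrite size_map; split=> //.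
  by apply/admissible_mapS; rewrite -def_s.
move=> [s' /mem_words[sz adm] ->]; split; first by apply/negP => /mapP[].
by apply/mem_words; rewrite size_map admissible_mapS.
Qed.

(** The bijection drops the leading 0, which [wt_pos] ignores. *)
Lemma sum_words_head0 k n :
  \sum_(s <- words k.+1 n.+1 | head 1%N s == 0%N) wt_pos s =
  \sum_(s <- words k.+2 n) wt_pos s.
Proof.
rewrite -big_filter -[RHS](big_map (cons 0%N) xpredT wt_pos).
apply: perm_big; apply: uniq_perm.
- by rewrite filter_uniq // words_uniq.
- by rewrite map_inj_uniq ?words_uniq // => s s' [].
move=> s; rewrite mem_filter; apply/andP/mapP => [[s0 /mem_words[sz adm]]|].
  case: s s0 sz adm => //= x s /eqP-> [sz] adm; exists s => //.
  by apply/mem_words; split=> //; apply/admissible_cons0.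
move=> [s' /mem_words[sz adm] ->]; split=> //.
by apply/mem_words; rewrite /= sz admissible_cons0.
Qed.

(** By [unimodal_last0] the words on the left end in 0, and that 0 is deleted. The empty word is
    excluded on the right, since appending 0 to it gives a word starting with 0. *)
Lemma sum_words_last0 k n :
  \sum_(s <- words k.+1 n.+1 | (head 1%N s != 0%N) && (0%N \in s)) wt_pos s =
  \sum_(s <- words k.+1 n | (head 1%N s != 0%N) && (s != [::])) wt_pos s.
Proof.
have wt0 s : wt_pos (rcons s 0%N) = wt_pos s by rewrite /wt_pos filter_rcons.
rewrite -big_filter -[RHS]big_filter -[RHS](eq_bigr _ (fun s _ => wt0 s)).
rewrite -[RHS](big_map (rcons^~ 0%N) xpredT wt_pos).
apply: perm_big; apply: uniq_perm.
- by rewrite filter_uniq // words_uniq.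
- rewrite map_inj_uniq; last exact: rcons_injl.
  by rewrite filter_uniq ?words_uniq.
move=> s; rewrite mem_filter; apply/andP/mapP.
  move=> [/andP[hd s0] /mem_words[sz adm]].
  have [s' def_s] := unimodal_last0 (proj2 adm) hd s0.
  rewrite {s s0}def_s size_rcons in hd sz adm *; case: sz => sz.
  exists s' => //; rewrite mem_filter; apply/andP; split.
    by case: s' hd {sz adm} => //= x s' ->.
  by apply/mem_words; split=> //; apply/admissible_rcons0.
move=> [s']; rewrite mem_filter => /andP[/andP[hd nz] /mem_words[sz adm]] ->.
split; first by rewrite mem_rcons mem_head andbT; case: s' hd nz {sz adm}.
by apply/mem_words; rewrite size_rcons sz admissible_rcons0.
Qed.

(** * Generating series and their recurrences *)

Definition gf_words k : fps {poly rat} :=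
  Fps (fun n => \sum_(s <- words k n) wt s).
Definition gf_pos k : fps {poly rat} :=
  Fps (fun n => \sum_(s <- words k.+1 n) wt_pos s).
(** The default 1 of [head] makes the empty word count here, whence the [- 1] in [gf_headE]. *)
Definition gf_head k : fps {poly rat} :=
  Fps (fun n => \sum_(s <- words k.+1 n | head 1%N s != 0%N) wt_pos s).

Lemma words_0 k : words k 0 = [:: [::]].
Proof.
apply: perm_small_eq => //; apply: uniq_perm => //; first exact: words_uniq.
move=> s; rewrite inE; apply/mem_words/eqP => [[/size0nil]//|->].
by split=> //; split=> [i|i j l] //=; rewrite ltn0.
Qed.

Lemma words_bound0 n : words 0 n.+1 = [::].
Proof.
case: (words 0 n.+1) (@mem_words 0 n.+1) => // s ss mem_s.
have /mem_s[sz [bnd _]] : s \in s :: ss by rewrite mem_head.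
by have := bnd 0%N; rewrite sz => /(_ isT).
Qed.

Lemma fcoefXM (R : comNzRingType) (f : fps R) n :
  fcoef (fpsX * f) n = if n is m.+1 then fcoef f m else 0.
Proof.
case: n => [|n]; first by rewrite fcoefM0 mul0r.
rewrite fcoefM !big_ord_recl /= mul0r add0r mul1r subSS subn0 big1 ?addr0 //.
by move=> i _; rewrite mul0r.
Qed.

Lemma fpsX_divides (R : comNzRingType) (f : fps R) :
  fcoef f 0 = 0 -> exists g, f = fpsX * g.
Proof.
move=> f0; exists (Fps (fun n => fcoef f n.+1)); apply/fpsP => -[|n].
  by rewrite fcoefXM f0.
by rewrite fcoefXM.
Qed.

Lemma fcoefCM (R : comNzRingType) (c : R) (f : fps R) n :
  fcoef (fpsC c * f) n = c * fcoef f n.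
Proof.
rewrite fcoefM big_ord_recl /= subn0 big1 ?addr0 // => i _.
by rewrite mul0r.
Qed.

Lemma gf_words_bound0 : gf_words 0 = 1.
Proof.
apply/fpsP => n; rewrite fcoef1; case: n => [|n] /=.
  by rewrite words_0 big_seq1 /wt expr0.
by rewrite words_bound0 big_nil.
Qed.

(** Words without 0 contribute T_k in either weight; for the others [wt] is t times [wt_pos], which
    leaves t (F_k - T_k). *)
Lemma gf_wordsS k :
  gf_words k.+1 = fpsC 'X * gf_pos k + (1 - fpsC 'X) * gf_words k.
Proof.
rewrite mulrBl mul1r addrCA -mulrBr; apply/fpsP => n.
rewrite fcoefD fcoefCM fcoefB /= -(sum_words_pos k).
rewrite (bigID (fun s => 0%N \notin s)) /=; congr (_ + _).
  by apply: eq_bigr => s /negPf s0; rewrite wtE s0 mul1r.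
rewrite [X in X - _](bigID (fun s => 0%N \notin s)) /= addrC addrK mulr_sumr.
by apply: eq_bigr => s /negPn s0; rewrite wtE s0.
Qed.

Lemma gf_posE k : gf_pos k = gf_head k + fpsX * gf_pos k.+1.
Proof.
apply/fpsP => n; rewrite fcoefD fcoefXM /=.
case: n => [|n]; first by rewrite words_0 !big_cons !big_nil /= !addr0.
by rewrite (bigID (fun s => head 1%N s == 0%N)) /= sum_words_head0 addrC.
Qed.

(** Words without 0 contribute T_k; the others lose their final 0 by [sum_words_last0]. *)
Lemma gf_headE k : gf_head k = gf_words k + fpsX * (gf_head k - 1).
Proof.
apply/fpsP => n; rewrite fcoefD fcoefXM.
case: n => [|n]; first by rewrite /= !words_0 !big_cons !big_nil /= !addr0.
rewrite fcoefB fcoef1 /= -(sum_words_pos k) (bigID (fun s => 0%N \in s)) /=.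
rewrite addrC sum_words_last0; congr (_ + _).
  by apply: eq_bigl => -[|[|x] s].
(* Discarding the empty word costs exactly the coefficient of the series 1. *)
rewrite -[RHS]/(_ + _) [in RHS](bigID (fun s => s != [::])) /= -addrA.
rewrite [X in _ + X](_ : _ = 0) ?addr0 //; apply/eqP; rewrite subr_eq0; apply/eqP.
case: n => [|n].
  by rewrite words_0 big_cons big_nil /wt_pos /= expr0 addr0.
rewrite big_seq_cond big_pred0 // => s; apply/negP => /and3P[/mem_words[sz _] _].
by rewrite negbK => /eqP s0; rewrite s0 in sz.
Qed.

(** Induction on the index [n] of the coefficient, then on [k]. The factor z sends [K k] and
    [F k.+1] on the right to index [n - 1], where all [k] are settled; at index [n] the order is T,
    K, F at [k], then T at [k.+1]. *)
Lemma gf_words_uniq (T K F : nat -> fps {poly rat}) :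
  T 0%N = 1 ->
  (forall k, T k.+1 = fpsC 'X * F k + (1 - fpsC 'X) * T k) ->
  (forall k, F k = K k + fpsX * F k.+1) ->
  (forall k, K k = T k + fpsX * (K k - 1)) ->
  forall k, T k = gf_words k.
Proof.
move=> T0 TS FE KE.
suff eqT n k : [/\ fcoef (T k) n = fcoef (gf_words k) n,
    fcoef (K k) n = fcoef (gf_head k) n & fcoef (F k) n = fcoef (gf_pos k) n].
  by move=> k; apply/fpsP => n; have [] := eqT n k.
elim/ltn_ind: n k => n IHn.
have eqKF k : fcoef (T k) n = fcoef (gf_words k) n ->
    fcoef (K k) n = fcoef (gf_head k) n /\ fcoef (F k) n = fcoef (gf_pos k) n.
  move=> eqTk.
  have eqK : fcoef (K k) n = fcoef (gf_head k) n.
    rewrite KE gf_headE !fcoefD !fcoefXM eqTk; congr (_ + _).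
    case: n IHn {eqTk} => // n IHn; rewrite !fcoefB.
    by have [_ ->] := IHn n (ltnSn n) k.
  split=> //; rewrite FE gf_posE !fcoefD !fcoefXM eqK; congr (_ + _).
  case: n IHn {eqTk eqK} => // n IHn.
  by have [_ _ ->] := IHn n (ltnSn n) k.+1.
elim=> [|k [eqTk _ eqFk]].
  by have eqT0 : fcoef (T 0%N) n = fcoef (gf_words 0) n;
     [rewrite T0 gf_words_bound0 | case: (eqKF _ eqT0)].
suff eqTS : fcoef (T k.+1) n = fcoef (gf_words k.+1) n.
  by case: (eqKF _ eqTS).
rewrite TS gf_wordsS !mulrBl !mul1r !fcoefD !fcoefN !fcoefCM.
by rewrite eqTk eqFk.
Qed.

(** An inversion sequence corresponds to the list of its values; with positions from 0 its bound is
    the case [k = 1]. *)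
Lemma Bgf_words : Bgf = gf_words 1.
Proof.
apply/fpsP => n /=.
pose f (e : {ffun 'I_n -> 'I_n}) := [seq val (e i) | i <- enum 'I_n].
have sz_f e : size (f e) = n by rewrite size_map size_enum_ord.
have nth_f e (i : 'I_n) : nth 0%N (f e) i = e i.
  by rewrite (nth_map i) ?size_enum_ord ?nth_ord_enum.
have wt_f e : wt (f e) = 'X^(dist e).
  rewrite /wt /dist /f (map_comp val e) undup_map_inj; last exact: val_inj.
  rewrite size_map imset_card -(card_uniqP (undup_uniq _)).
  by congr ('X^_); apply: eq_card => x; rewrite mem_undup.
rewrite -(eq_bigr _ (fun e _ => wt_f e)) -big_enum /=.
rewrite -[LHS](big_map f xpredT wt); apply: perm_big; apply: uniq_perm.
- rewrite map_inj_uniq ?enum_uniq // => e e' ee'.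
  by apply/ffunP => i; apply/val_inj; rewrite /= -!nth_f ee'.
- exact: words_uniq.
move=> s; apply/mapP/mem_words => [[e]|[sz [bnd uni]]].
  rewrite mem_enum !inE => /andP[/forallP bnd av] ->; split=> //; split.
    move=> i; rewrite sz_f => lt_i.
    by rewrite (nth_f e (Ordinal lt_i)) addn1 bnd.
  move=> i j l /andP[ij jl]; rewrite sz_f => lt_l.
  have lt_j := ltn_trans jl lt_l; have lt_i := ltn_trans ij lt_j.
  rewrite (nth_f e (Ordinal lt_i)) (nth_f e (Ordinal lt_j)).
  rewrite (nth_f e (Ordinal lt_l)) => eij; rewrite leqNgt; apply/negP => ejl.
  case/negP: av; apply/existsP; exists (Ordinal lt_i).
  apply/existsP; exists (Ordinal lt_j); apply/existsP; exists (Ordinal lt_l).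
  by rewrite /= ij jl eij.
have lt_s (i : 'I_n) : (nth 0 s i < n)%N.
  by have := bnd i; rewrite sz => /(_ (ltn_ord i)); have := ltn_ord i; lia.
pose e := [ffun i : 'I_n => Ordinal (lt_s i)].
have def_s : s = f e.
  apply: (@eq_from_nth _ 0%N); rewrite ?sz_f // => i; rewrite sz => lt_i.
  by rewrite (nth_f e (Ordinal lt_i)) ffunE.
exists e => //; rewrite mem_enum !inE; apply/andP; split.
  apply/forallP => i; rewrite ffunE /=.
  by have := bnd i; rewrite sz addn1; apply.
apply/negP => /existsP[i /existsP[j /existsP[l]]]; rewrite !ffunE /=.
move=> /and4P[ij jl eij]; rewrite ltnNge (uni i) ?ij ?sz //.
Qed.

End Series.

(* The quotient is taken in the fraction field of rat[t][[z]], since the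
   denominator 2z(2-z) is not invertible as a power series. *)
Theorem theorem5p3 :
  let z : fps {poly rat} := fpsX in
  let t : fps {poly rat} := fpsC 'X in
  FracField.tofrac Bgf =
    FracField.tofrac
      (1 + z * (2 - t) - z ^+ 2 * (1 - t)
       - (1 - z) * fps_sqrt ((1 + z - z * t) ^+ 2
                             - (4 * z * (1 - z + z * t)) / (1 - z)))
    / FracField.tofrac (2 * z * (2 - z)).
Proof.
move=> z t; set D := _ - _ / _.
have U2 : (2 : {poly rat}) \is a GRing.unit.
  by rewrite -(rmorph_nat (@polyC rat)) rmorph_unit.
have two0 : fcoef (2 : fps {poly rat}) 0 = 2.
  by rewrite -[2 in LHS]/(1 + 1) fcoefD fcoef1.
have z0 : fcoef z 0 = 0 by [].
have zM0 f : fcoef (z * f) 0 = 0 by rewrite fcoefM0 z0 mul0r.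
have U2f : (2 : fps {poly rat}) \is a GRing.unit by rewrite fps_unitE two0.
have U1z : 1 - z \is a GRing.unit.
  by rewrite fps_unitE fcoefB fcoef1 z0 subr0 unitr1.
have U2z : 2 - z \is a GRing.unit by rewrite fps_unitE fcoefB two0 z0 subr0.
have z_neq0 : z != 0.
  by apply/eqP => /fpsP /(_ 1%N) /eqP; rewrite fcoef0 /= oner_eq0.
have D0 : fcoef D 0 = 1.
  rewrite fcoefB expr2 fcoefM0 -[4 * z]mulrC -!mulrA zM0 subr0.
  by rewrite fcoefB fcoefD fcoef1 z0 zM0 addr0 subr0 mulr1.
have := fps_sqrtK U2 D0; have := fcoef_sqrt0 D.
move: (fps_sqrt D) => s s0 sK.
(* The left side has constant coefficient 0, so z divides it, and 2 is invertible. *)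
have [Y defY] : exists Y, 1 + z - z * t - s = 2 * z * Y.
  have [|Y2 ->] := @fpsX_divides _ (1 + z - z * t - s).
    by rewrite !fcoefB fcoefD fcoef1 z0 zM0 s0 addr0 subr0 subrr.
  by exists (2^-1 * Y2); rewrite mulrCA !mulrA mulVr // mul1r.
have {defY} defs : s = 1 + z - z * t - 2 * z * Y by rewrite -defY; ring.
have Uw : 1 - z * Y \is a GRing.unit.
  by rewrite fps_unitE fcoefB fcoef1 zM0 subr0 unitr1.
(* The three inverses become variables tied only by [uE], [vE], [wE], which makes the remaining
   identities polynomial. *)
rewrite /D in sK; have := mulrV U1z; have := mulrV U2z; have := mulrV Uw.
move: (1 - z)^-1 (2 - z)^-1 (1 - z * Y)^-1 sK => u v w sK wE vE uE.
have zuE : z * u = u - 1 by rewrite -[in RHS]uE; ring.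
have zYwE : z * Y * w = w - 1 by rewrite -[in RHS]wE; ring.
(* This is the part free of Y in F_k = K_k + z F_(k+1), for the closed forms below. *)
have v_split : v = (v - z) * u + z * v.
  have zvE : z * v = 2 * v - 1 by rewrite -[X in _ - X]vE; ring.
  have uvE : u * v = u - v by rewrite -[u in RHS]mulr1 -vE; ring: zuE.
  by rewrite mulrBl [v * u]mulrC uvE zuE zvE; ring.
have four_z : 4 * z != 0.
  rewrite (_ : 4 * z = 2 * (2 * z)); last by ring.
  by rewrite !mulf_neq0 //; apply: contraTneq U2f => ->; rewrite unitr0.
(* The quadratic for Y is s^2 = D, read through the difference (1 + z - z t)^2 - s^2 and cancelled
   by 4 z. *)
have Yquad : (1 - z) * Y * (1 - z * Y) = t + (1 - t) * (1 - z) * (1 - z * Y).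
  apply: (mulfI four_z).
  transitivity ((1 - z) * ((1 + z - z * t) ^+ 2 - s ^+ 2)
    + 4 * z * (1 - t) * (1 - z) * (1 - z * Y) - 4 * z * (1 - z) * (1 - t)).
    by rewrite defs; ring.
  rewrite sK; ring: zuE.
(* Division by (1 - z) (1 - z Y) shows Y as the ratio of the geometric part of T: t u w comes from
   F_k and 1 - t from T_k. *)
have YE : Y = t * u * w + 1 - t.
  transitivity (((1 - z) * u) * ((1 - z * Y) * w) * Y).
    by rewrite uE wE !mul1r.
  transitivity ((1 - z) * Y * (1 - z * Y) * (u * w)); first by ring.
  rewrite Yquad.
  transitivity (t * u * w + (1 - t) * ((1 - z) * u) * ((1 - z * Y) * w)).
    by ring.
  by rewrite uE wE; ring.
have Bgf_eq : Bgf = v + (1 - z) * v * Y.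
  (* K is solved from its equation as (T - z) / (1 - z); F is a constant plus a multiple of Y^k,
     whose factor u w is forced by the Y^k terms of the equation for F. *)
  rewrite Bgf_words -(@gf_words_uniq (fun k => v + (1 - z) * v * Y ^+ k)
    (fun k => (v + (1 - z) * v * Y ^+ k - z) * u)
    (fun k => v + (1 - z) * v * u * w * Y ^+ k)) ?expr1 // => [|k|k|k].
  - by rewrite expr0 -[RHS]vE; ring.
  - by rewrite exprS {1}YE -/t; ring.
  - by rewrite exprS -/z [X in X + _ = _]v_split; ring: zYwE.
  - by rewrite -/z; ring: zuE.
rewrite Bgf_eq; apply: (canRL (mulfK _)).
  rewrite tofrac_eq0 !mulf_neq0 //.
    by apply: contraTneq U2f => ->; rewrite unitr0.
  by apply: contraTneq U2z => ->; rewrite unitr0.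
rewrite -tofracM; congr FracField.tofrac.
transitivity (2 * z * ((2 - z) * v) * (1 + (1 - z) * Y)); first by ring.
by rewrite vE defs; ring.
Qed.
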